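(* Let $\{\mathcal{A},G,\sigma,\alpha\}$ be a $G$-crossed system with $G\neq\{e\}$ and $\mathcal{A}$ commutative. Then $$I\cap\mathrm{Comm}(\tilde{\mathcal{A}})\neq\{0\}$$ for every non-zero two-sided ideal $I$ in $\mathcal{A}\rtimes_\alpha^\sigma G$.
   Context: A $G$-crossed system is a quadruple $\{\mathcal{A},G,\sigma,\alpha\}$ consisting of a unital associative ring $\mathcal{A}$, a group $G$ with unit $e$, a map $\sigma:G\to\mathrm{Aut}(\mathcal{A})$, $x\mapsto\sigma_x$, into the ring automorphisms of $\mathcal{A}$, and a map $\alpha:G\times G\to U(\mathcal{A})$ into the group of invertible elements of $\mathcal{A}$, such that for all $x,y,z\in G$, $a\in\mathcal{A}$: (i) $\sigma_x(\sigma_y(a))=\alpha(x,y)\,\sigma_{xy}(a)\,\alpha(x,y)^{-1}$; (ii) $\alpha(x,y)\,\alpha(xy,z)=\sigma_x(\alpha(y,z))\,\alpha(x,yz)$; (iii) $\alpha(x,e)=\alpha(e,x)=1_{\mathcal{A}}$. The crossed product $\mathcal{A}\rtimes_\alpha^\sigma G$ is the free left $\mathcal{A}$-module with basis $\{\overline{g}: g\in G\}$ (a copy of $G$), made into an associative unital ring by the biadditive multiplication determined by $(a_1\overline{x})(a_2\overline{y})=a_1\sigma_x(a_2)\,\alpha(x,y)\,\overline{xy}$. Its elements are formal sums $\sum_{g\in G}a_g\overline{g}$ with $a_g\in\mathcal{A}$, all but finitely many zero. $\tilde{\mathcal{A}}=\{a\overline{e}\mid a\in\mathcal{A}\}$ is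 the embedded copy of $\mathcal{A}$, and $\mathrm{Comm}(\tilde{\mathcal{A}})=\{b\in\mathcal{A}\rtimes_\alpha^\sigma G\mid ab=ba\ \forall a\in\tilde{\mathcal{A}}\}$. *)

(* Defs.v *)
From HB Require Import structures.
From mathcomp Require Import all_boot all_algebra finmap boolp classical_sets.
From mathcomp.multinomials Require Import xfinmap monalg.

Set Implicit Arguments.
Unset Strict Implicit.
Unset Printing Implicit Defensive.

Import GRing.Theory.

Local Open Scope classical_set_scope.
Local Open Scope ring_scope.

(* [cs_alpha] takes values in the units of [A]: since a [pzRingType] carries no
   inverse function, the (unique) inverses are part of the data. *)
Record crossed_system (A : pzRingType) (G : groupType) := CrossedSystem {
  cs_sigma : G -> {rmorphism A -> A};
  cs_alpha : G -> G -> A;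
  cs_alphaV : G -> G -> A;
  cs_sigma_bij : forall x, bijective (cs_sigma x);
  cs_alphaVK : forall x y, cs_alphaV x y * cs_alpha x y = 1;
  cs_alphaKV : forall x y, cs_alpha x y * cs_alphaV x y = 1;
  cs_twist : forall x y a,
    cs_sigma x (cs_sigma y a) =
      cs_alpha x y * cs_sigma (x * y)%g a * cs_alphaV x y;
  cs_cocycle : forall x y z,
    cs_alpha x y * cs_alpha (x * y)%g z =
      cs_sigma x (cs_alpha y z) * cs_alpha x (y * z)%g;
  cs_alphax1 : forall x, cs_alpha x 1%g = 1;
  cs_alpha1x : forall x, cs_alpha 1%g x = 1
}.

(* The carrier is the type of finitely supported functions from [G] to [A].
   [{malg A[G]}] has no multiplication of its own here, because a group is not
   a [monomType]; [u@_g] is the coefficient of [u] at [g]. *)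
Definition crossed_product (A : pzRingType) (G : groupType)
  (S : crossed_system A G) : Type := {malg A[G]}.

HB.instance Definition _ (A : pzRingType) (G : groupType)
  (S : crossed_system A G) := GRing.Zmodule.on (crossed_product S).

Section CrossedProduct.
Context (A : pzRingType) (G : groupType) (S : crossed_system A G).

Local Notation sigma := (cs_sigma S).
Local Notation alpha := (cs_alpha S).
Local Notation CP := (crossed_product S).

Implicit Types (a b c : A) (x y z : G) (u v w : CP).

Definition cp_term a x : CP := << a *g x >>.

Definition cp_scale a u : CP := \sum_(x <- msupp u) cp_term (a * u@_x) x.

Definition cp_one : CP := cp_term 1 1%g.

Definition cp_mul u v : CP :=
  \sum_(x <- msupp u) \sum_(y <- msupp v)
    cp_term (u@_x * sigma x v@_y * alpha x y) (x * y)%g.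

Lemma cp_term0 x : cp_term 0 x = 0.
Proof. exact: (@monalgU0 G A). Qed.

Lemma cp_termD x a b : cp_term (a + b) x = cp_term a x + cp_term b x.
Proof. exact: (@monalgUD G A). Qed.

Lemma cp_termE u : u = \sum_(x <- msupp u) cp_term u@_x x.
Proof. exact: (@monalgE G A). Qed.

Lemma cp_scaleE a u x : (cp_scale a u)@_x = a * u@_x.
Proof.
rewrite {2}[u]cp_termE /cp_scale !(raddf_sum (mcoeff x)) mulr_sumr.
by apply/eq_bigr=> /= i _; rewrite !mcoeffU mulrnAr.
Qed.

Lemma cp_scaleA a b u : cp_scale a (cp_scale b u) = cp_scale (a * b) u.
Proof. by apply/(@malgP G A)=> x; rewrite !cp_scaleE mulrA. Qed.

Lemma cp_scale1 u : cp_scale 1 u = u.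
Proof. by apply/(@malgP G A)=> x; rewrite !cp_scaleE mul1r. Qed.

Lemma cp_scaleDr a u v : cp_scale a (u + v) = cp_scale a u + cp_scale a v.
Proof.
by apply/(@malgP G A)=> x; rewrite mcoeffD !cp_scaleE mcoeffD mulrDr.
Qed.

Lemma cp_scaleDl u a b : cp_scale (a + b) u = cp_scale a u + cp_scale b u.
Proof. by apply/(@malgP G A)=> x; rewrite mcoeffD !cp_scaleE mulrDl. Qed.

HB.instance Definition _ := GRing.Zmodule_isLmodule.Build A CP
  cp_scaleA cp_scale1 cp_scaleDr cp_scaleDl.

Local Open Scope fset_scope.

Lemma cp_mulw (d1 d2 : {fset G}) u v :
  msupp u `<=` d1 -> msupp v `<=` d2 ->
  cp_mul u v = \sum_(x <- d1) \sum_(y <- d2)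
    cp_term (u@_x * sigma x v@_y * alpha x y) (x * y)%g.
Proof.
move=> le1 le2; rewrite /cp_mul (big_fset_incl _ le1) /=.
  apply/eq_bigr=> x _; apply/big_fset_incl => // y _ /mcoeff_outdom ->.
  by rewrite rmorph0 mulr0 mul0r cp_term0.
move=> x _ /mcoeff_outdom ux.
by rewrite big1 // => y _; rewrite ux !mul0r cp_term0.
Qed.

Lemma cp_mulDl : left_distributive cp_mul +%R.
Proof.
move=> u v w.
rewrite (cp_mulw (msuppD_le _ _) (fsubset_refl _)).
rewrite (cp_mulw (fsubsetUl _ (msupp v)) (fsubset_refl _)).
rewrite (cp_mulw (fsubsetUr (msupp u) _) (fsubset_refl _)).
rewrite -big_split /=; apply/eq_bigr=> x _.
rewrite -big_split /=; apply/eq_bigr=> y _.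
by rewrite mcoeffD !mulrDl cp_termD.
Qed.

Lemma cp_mulDr : right_distributive cp_mul +%R.
Proof.
move=> w u v.
rewrite (cp_mulw (fsubset_refl _) (msuppD_le _ _)).
rewrite (cp_mulw (fsubset_refl _) (fsubsetUl _ (msupp v))).
rewrite (cp_mulw (fsubset_refl _) (fsubsetUr (msupp u) _)).
rewrite -big_split /=; apply/eq_bigr=> x _.
rewrite -big_split /=; apply/eq_bigr=> y _.
by rewrite mcoeffD rmorphD mulrDr mulrDl cp_termD.
Qed.

Lemma cp_mul0u : left_zero 0 cp_mul.
Proof. by move=> u; rewrite /cp_mul msupp0 big_seq_fset0. Qed.

Lemma cp_mulu0 : right_zero 0 cp_mul.
Proof.
by move=> u; rewrite /cp_mul big1 // => x _; rewrite msupp0 big_seq_fset0.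
Qed.

Lemma cp_mul_term a x b y :
  cp_mul (cp_term a x) (cp_term b y) =
    cp_term (a * sigma x b * alpha x y) (x * y)%g.
Proof.
by rewrite (cp_mulw msuppU_le msuppU_le) !big_seq_fset1 !mcoeffUU.
Qed.

Lemma cp_mul_suml (I : Type) (r : seq I) (F : I -> CP) v :
  cp_mul (\sum_(i <- r) F i) v = \sum_(i <- r) cp_mul (F i) v.
Proof.
exact: (big_morph (cp_mul^~ v) (fun _ _ => cp_mulDl _ _ _) (cp_mul0u _)).
Qed.

Lemma cp_mul_sumr (I : Type) (r : seq I) (F : I -> CP) u :
  cp_mul u (\sum_(i <- r) F i) = \sum_(i <- r) cp_mul u (F i).
Proof.
exact: (big_morph (cp_mul u) (fun _ _ => cp_mulDr _ _ _) (cp_mulu0 _)).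
Qed.

Lemma cs_sigma1 a : sigma 1%g a = a.
Proof.
apply: (bij_inj (cs_sigma_bij S 1%g)); rewrite cs_twist mul1g cs_alpha1x mul1r.
by have := cs_alphaVK S 1%g 1%g; rewrite cs_alpha1x mulr1 => ->; rewrite mulr1.
Qed.

Lemma cp_mul_termA a x b y c z :
  cp_mul (cp_term a x) (cp_mul (cp_term b y) (cp_term c z)) =
  cp_mul (cp_mul (cp_term a x) (cp_term b y)) (cp_term c z).
Proof.
rewrite !cp_mul_term mulgA !rmorphM cs_twist; congr cp_term.
rewrite -!mulrA; congr (_ * (_ * _)); rewrite -cs_cocycle !mulrA.
by congr (_ * _); rewrite -mulrA cs_alphaVK mulr1.
Qed.

Lemma cp_mulA : associative cp_mul.
Proof.
move=> u v w; rewrite [u]cp_termE [v]cp_termE [w]cp_termE.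
rewrite !cp_mul_suml; apply/eq_bigr=> x _.
rewrite [LHS]cp_mul_sumr [in RHS](cp_mul_sumr _ _ (cp_term _ _)).
rewrite [RHS]cp_mul_suml; apply/eq_bigr=> y _.
rewrite !cp_mul_sumr; apply/eq_bigr=> z _.
exact: cp_mul_termA.
Qed.

Lemma cp_mul1u : left_id cp_one cp_mul.
Proof.
move=> u; rewrite [u]cp_termE cp_mul_sumr; apply/eq_bigr=> x _.
by rewrite cp_mul_term cs_sigma1 cs_alpha1x mul1r mulr1 mul1g.
Qed.

Lemma cp_mulu1 : right_id cp_one cp_mul.
Proof.
move=> u; rewrite [u]cp_termE cp_mul_suml; apply/eq_bigr=> x _.
by rewrite cp_mul_term rmorph1 cs_alphax1 !mulr1 mulg1.
Qed.

HB.instance Definition _ := GRing.Zmodule_isPzRing.Build CP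
  cp_mulA cp_mul1u cp_mulu1 cp_mulDl cp_mulDr.

Local Open Scope classical_set_scope.

Definition cp_base : set CP := [set cp_term a 1%g | a in [set: A]].

End CrossedProduct.

Arguments cp_base {A G} S.

Definition commutant (R : pzRingType) (B : set R) : set R :=
  [set b | forall a, B a -> a * b = b * a].

Record two_sided_ideal (R : pzRingType) (I : set R) : Prop := TwoSidedIdeal {
  ideal_0 : I 0;
  ideal_B : forall u v, I u -> I v -> I (u - v);
  ideal_Ml : forall r u, I u -> I (r * u);
  ideal_Mr : forall r u, I u -> I (u * r)
}.

(* Main.v *)
Require Import Defs.
From mathcomp Require Import all_boot all_algebra classical_sets.
From mathcomp Require Import finmap boolp.
From mathcomp.multinomials Require Import monalg.

Import GRing.Theory.

Local Open Scope classical_set_scope.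
Local Open Scope ring_scope.

(** Among the non-zero elements of the ideal, one with the fewest coefficients
    can be moved, by right multiplication with a basis element, so that its
    coefficient at the identity of the group is non-zero; the twists involved
    are units, so the support only gets translated
    ([mul_basis_coef1_neq0], [card_supp_mul_basis]).
    If such an element [u] fails to commute with some [a] in the base ring, then
    [a u - u a] is again a non-zero element of the ideal.  Its support lies in
    that of [u], and its coefficient at the identity is
    [a * u@_1 - u@_1 * a = 0], because the base ring is commutative and the
    identity of the group acts trivially on it ([card_supp_base_commutator]).
    So its support is strictly smaller, which contradicts minimality.  The
    descent is organised as an induction on a bound for the size of the
    support. *)

Section Coefficients.
Context {A : pzRingType} {G : groupType} {S : crossed_system A G}.

Local Notation CP := (crossed_product S).

Implicit Types (a b : A) (x y z : G) (u : CP).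

(** Translating on the right by [y] is injective on the group, so every
    coefficient of the product comes from a single coefficient of [u]. *)
Lemma mcoeff_mul_term u b y z :
  (u * cp_term S b y : CP)@_(z * y)%g =
    u@_z * cs_sigma S z b * cs_alpha S z y.
Proof.
(* Both sides are additive in [u], which may thus be taken to be a term. *)
rewrite [in RHS](cp_termE u) [X in X * cp_term _ _ _](cp_termE u) mulr_suml.
rewrite !(raddf_sum (mcoeff _)) !mulr_suml; apply/eq_bigr=> x _ /=.
rewrite [X in mcoeff _ X]cp_mul_term !mcoeffU.
rewrite (inj_eq (@mulIg G y)); case: eqP => [->|_]; first by rewrite !mulr1n.
by rewrite !mulr0n !mul0r.
Qed.

Lemma mcoeff_mul_base u a z :
  (u * cp_term S a 1%g : CP)@_z = u@_z * cs_sigma S z a.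
Proof. by rewrite -[z in LHS]mulg1 mcoeff_mul_term cs_alphax1 mulr1. Qed.

Lemma mcoeff_base_mul a u z : (cp_term S a 1%g * u : CP)@_z = a * u@_z.
Proof.
rewrite [in RHS](cp_termE u) [X in _ * X](cp_termE u) mulr_sumr.
rewrite !(raddf_sum (mcoeff _)) !mulr_sumr; apply/eq_bigr=> x _ /=.
rewrite [X in mcoeff _ X]cp_mul_term !mcoeffU mul1g.
by rewrite cs_sigma1 cs_alpha1x mulr1 mulrnAr.
Qed.

(** The new coefficient at the identity is [u@_x] times a unit. *)
Lemma mul_basis_coef1_neq0 u x :
  u@_x != 0 -> (u * cp_term S 1 x^-1%g : CP)@_1%g != 0.
Proof.
apply: contra_neq; rewrite -(mulgV x) mcoeff_mul_term rmorph1 mulr1 => ux0.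
by rewrite -[LHS]mulr1 -(cs_alphaKV S x x^-1%g) mulrA ux0 mul0r.
Qed.

Lemma card_supp_mul_basis u b y :
  (#|` msupp (u * cp_term S b y : CP)| <= #|` msupp u|)%N.
Proof.
apply: (@leq_trans #|` [fset (x * y)%g | x in msupp u]%fset|);
  last exact: leq_imfset_card.
apply/fsubset_leq_card/fsubsetP => z; rewrite -(mulgVK y z) -mcoeff_neq0.
rewrite mcoeff_mul_term => nz; apply/imfsetP; exists (z / y)%g => //=.
by rewrite -mcoeff_neq0; apply: contra_neq nz => ->; rewrite !mul0r.
Qed.

End Coefficients.

Section CommutativeBase.
Context {A : comPzRingType} {G : groupType} {S : crossed_system A G}.

Local Notation CP := (crossed_product S).

(** This is the only place where commutativity of the base ring enters: it
    makes the coefficient at the identity disappear. *)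
Lemma card_supp_base_commutator (u : CP) (a : A) : u@_1%g != 0 ->
  (#|` msupp (cp_term S a 1%g * u - u * cp_term S a 1%g : CP)|
     < #|` msupp u|)%N.
Proof.
move=> u1; have coefE z :
    (cp_term S a 1%g * u - u * cp_term S a 1%g : CP)@_z =
      a * u@_z - u@_z * cs_sigma S z a.
  by rewrite [LHS]mcoeffB mcoeff_base_mul mcoeff_mul_base.
rewrite [X in (_ < X)%N](cardfsD1 1%g) -mcoeff_neq0 u1 ltnS.
apply/fsubset_leq_card/fsubsetP => z; rewrite in_fsetD1 -!mcoeff_neq0 coefE.
case: (eqVneq z 1%g) => [->|_] /=.
  by rewrite cs_sigma1 [a * _]mulrC subrr eqxx.
by apply: contra_neq => ->; rewrite mulr0 mul0r subr0.
Qed.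

Lemma ideal_meets_commutant (I : set CP) (u : CP) :
  two_sided_ideal I -> I u -> u != 0 ->
  exists v, [/\ I v, commutant (cp_base S) v & v != 0].
Proof.
move=> hI; have [n] := ubnP #|` msupp u|.
elim: n u => // n IHn u; rewrite ltnS => le_u_n Iu u0.
have [x ux] : exists x, u@_x != 0.
  apply/not_existsP => u_eq0; move/eqP: u0; apply.
  by apply/(@malgP G A) => x; rewrite mcoeff0; apply/eqP/negPn/negP/u_eq0.
(* Putting a non-zero coefficient at the identity is what lets the commutators
   taken below have a smaller support. *)
pose v : CP := u * cp_term S 1 x^-1%g.
have v1 : v@_1%g != 0 := mul_basis_coef1_neq0 u x ux.
have Iv : I v by apply: ideal_Mr.
have [Cv|/existsNP[_ /not_implyP[[a _ <-] av]]] :=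
    pselect (commutant (cp_base S) v).
  by exists v; split=> //; apply: contra_neq v1 => ->; rewrite mcoeff0.
apply: (IHn (cp_term S a 1%g * v - v * cp_term S a 1%g)).
- apply: leq_trans (card_supp_base_commutator v a v1) _.
  exact: leq_trans (card_supp_mul_basis _ _ _) le_u_n.
- by apply: ideal_B => //; [apply: ideal_Ml | apply: ideal_Mr].
- by rewrite subr_eq0; apply/eqP.
Qed.

End CommutativeBase.

Theorem theorem5p1 (A : comPzRingType) (G : groupType)
    (S : crossed_system A G) (hG : [set: G] <> [set 1%g])
    (I : set (crossed_product S)) (hI : two_sided_ideal I)
    (hI0 : I <> [set 0]) :
  I `&` commutant (cp_base S) <> [set 0].
Proof.
move=> IC0; apply: hI0; apply/seteqP; split=> [u Iu|_ ->]; last exact: ideal_0.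
apply/eqP/negPn/negP => u0.
have [v [Iv Cv /eqP v0]] := ideal_meets_commutant I u hI Iu u0.
by apply: v0; have: [set 0] v by rewrite -IC0.
Qed.
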